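(* Let $H$ be a complex Hilbert space and $\{\mathcal{U}(t)\}_{t\geq 0}$ a strongly continuous semigroup on $H$ with generator $\mathcal{L}$. Let $z\in D(\mathcal{L}^\dagger)$ with $z\neq0$, $\mathcal{P}:=(\cdot,z)(z,z)^{-1}z$, $\mathcal{Q}:=1-\mathcal{P}$, and let $x\in H$. Let $f(x,\cdot):\mathbb{R}_+\to\mathbb{C}$ be the unique continuous solution of the Volterra equation $$f(x,t)=(\mathcal{U}(t)\mathcal{Q}x,\mathcal{Q}\mathcal{L}^\dagger z)(z,z)^{-1}-\int_0^tf(x,t-s)\,(\mathcal{U}(s)z,\mathcal{Q}\mathcal{L}^\dagger z)(z,z)^{-1}\,ds,$$ and define $u(x,t):=\mathcal{P}x+\mathcal{U}(t)\mathcal{Q}x-\int_0^tf(x,t-s)\,\mathcal{U}(s)z\,ds$ for $t\ge0$. Then $u(x,\cdot)$ is a mild solution of the abstract Cauchy problem associated to $\overline{\mathcal{QL}}\mathcal{Q}$, i.e. $t\mapsto u(x,t)$ is continuous, and for every $t\ge0$, $\int_0^tu(x,s)\,ds\in D(\overline{\mathcal{QL}}\mathcal{Q})$ and $u(x,t)=x+\overline{\mathcal{QL}}\mathcal{Q}\int_0^tu(x,s)\,ds$.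
   Context: The scalar product $(\cdot,\cdot)$ on $H$ is conjugate-linear in its second argument. The generator is $\mathcal{L}x:=\lim_{h\searrow 0}\frac1h[\mathcal{U}(h)x-x]$ on the set $D(\mathcal{L})$ where the limit exists; $\dagger$ denotes the adjoint, the overbar the closure (the operator $\mathcal{QL}$ is closable under these assumptions); $D(\overline{\mathcal{QL}}\mathcal{Q})=\{y:\mathcal{Q}y\in D(\overline{\mathcal{QL}})\}$. Integrals are Bochner integrals. *)

(* Defs.v *)
From HB Require Import structures.
From mathcomp Require Import all_boot all_order all_algebra.
From mathcomp Require Import all_classical all_reals all_analysis.
From mathcomp Require Import complex.
Set Implicit Arguments. Unset Strict Implicit. Unset Printing Implicit Defensive.
Import Order.TTheory GRing.Theory Num.Theory.
Import numFieldNormedType.Exports.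
Local Open Scope classical_set_scope.
Local Open Scope ring_scope.

Section Defs.
Variable R : realType.
Local Notation C := (complex R).

Definition riemann_sum (V : normedModType C) (g : R -> V) (t : R) (n : nat) : V :=
  \sum_(k < n) ((t / n%:R)%:C%C *: g (k%:R * t / n%:R)).

(* integral over [0,t]; all integrands in the statement are continuous, where
   this coincides with the Bochner integral *)
Definition integral_0t (V : normedModType C) (g : R -> V) (t : R) : V :=
  lim (riemann_sum g t @ \oo).

(* generator of a semigroup, as a relation: gen U x y  <->  x \in D(L), L x = y *)
Definition generator (H : normedModType C) (U : R -> H -> H) (x y : H) : Prop :=
  (fun h : R => (h^-1)%:C%C *: (U h x - x)) @ 0^'+ --> y.

End Defs.

(* Main.v *)
(* Put v(t) := u(t) - P x = U(t) Q x - (f * U(.) z)(t).  Since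
   v(t + h) = U(h) v(t) - int_0^h f(t + r) U(h - r) z dr, the vector
   J(t) := int_0^t v lies in D(L) and L J(t) = v(t) - Q x + (int_0^t f) z.
   Pairing this identity with z, using z in D(L^dagger) and the Volterra equation
   f(s) (z,z) = (v(s), Q L^dagger z), yields (v(t), z) = c int_0^t (v(s), z) ds, so
   (v(t), z) = 0 by Gronwall.  Hence Q int_0^t u = J(t) lies in D(L) itself and
   Q L J(t) = v(t) - Q x = u(t) - x, so the pair already lies in the graph of QL. *)

Require Import Defs.
From HB Require Import structures.
From mathcomp Require Import all_boot all_order all_algebra.
From mathcomp Require Import all_classical all_reals all_analysis.
From mathcomp Require Import complex.
From mathcomp Require Import ring lra.
Import Order.TTheory GRing.Theory Num.Theory.
Import numFieldNormedType.Exports.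
Local Open Scope classical_set_scope.
Local Open Scope ring_scope.

Set Implicit Arguments.
Unset Strict Implicit.
Unset Printing Implicit Defensive.

(** The Volterra equation is tuned to the part [q] of L^dagger z orthogonal to z: since f (z,z) =
    (v, q), the pairing of (int f) z with z is (J, q), which cancels the [q] part of (J, L^dagger
    z). What remains is the multiple of z in L^dagger z, hence a homogeneous equation in (v, z)
    alone, with initial value (Q x, z) = 0. Most of the length comes from two obstacles. The
    integral is a limit of left Riemann sums, and the sums over [0,a], [a,a+b] and [0,a+b] do not
    share nodes; the additivity behind the formulas for v(t + h) and L J(t) is therefore proved
    weakly, by pairing with a vector, where a real primitive is available. Moreover, strong
    continuity is given only at 0 from the right; continuity of orbits, in particular from the left,
    rests on a local bound of the operator norms, which the uniform boundedness principle supplies.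
    The semigroup and f live on t >= 0 while the integral lemmas ask for continuity on the whole
    line; functions are therefore precomposed with [Num.max 0], which changes no value on the
    half-line. *)

Section RealNorm.
Variable R : realType.
Local Notation C := (complex R).

Lemma real_complex_gt0 (r : R) : (0 < r%:C%C) = (0 < r).
Proof. exact: (ltcR 0 r). Qed.

(** Norms over [C] take values in [C]; their real part lets all estimates be made in the ordered
    field [R]. *)
Definition nrm (V : normedModType C) (x : V) : R := complex.Re `|x|.

Section Basics.
Variable V : normedModType C.
Implicit Types x y : V.

Lemma normr_nrm x : `|x| = (nrm x)%:C%C.
Proof. by rewrite /nrm RRe_real// ger0_real. Qed.

Lemma nrm_ge0 x : 0 <= nrm x.
Proof. by have := normr_ge0 x; rewrite normr_nrm ler0c. Qed.

Lemma nrmD x y : nrm (x + y) <= nrm x + nrm y.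
Proof. by rewrite -lecR rmorphD/= -!normr_nrm ler_normD. Qed.

Lemma nrmN x : nrm (- x) = nrm x.
Proof. by rewrite /nrm normrN. Qed.

Lemma nrmB x y : nrm (x - y) <= nrm x + nrm y.
Proof. by rewrite -[in leRHS](nrmN y) nrmD. Qed.

Lemma nrm_distC x y : nrm (x - y) = nrm (y - x).
Proof. by rewrite -nrmN opprB. Qed.

Lemma nrm_triangle x y z : nrm (x - z) <= nrm (x - y) + nrm (y - z).
Proof. by rewrite (le_trans _ (nrmD _ _))// addrA subrK. Qed.

Lemma nrm0 : nrm (0 : V) = 0.
Proof. by rewrite /nrm normr0. Qed.

Lemma nrm0_eq0 x : nrm x = 0 -> x = 0.
Proof. by move=> x0; apply/normr0_eq0; rewrite normr_nrm x0. Qed.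

Lemma nrmZ (a : C) x : nrm (a *: x) = nrm (a : C^o) * nrm x.
Proof.
by apply: complexI; rewrite rmorphM/= -!normr_nrm normrZ.
Qed.

Lemma nrm_real (r : R) : nrm (r%:C%C : C^o) = `|r|.
Proof. by rewrite /nrm normc_def/= expr0n addr0 sqrtr_sqr. Qed.

Lemma nrmZr (r : R) x : nrm (r%:C%C *: x) = `|r| * nrm x.
Proof. by rewrite nrmZ nrm_real. Qed.

Lemma nrm_sum (I : Type) (s : seq I) (P : pred I) (F : I -> V) :
  nrm (\sum_(i <- s | P i) F i) <= \sum_(i <- s | P i) nrm (F i).
Proof.
elim/big_ind2 : _ => //; first by rewrite nrm0.
by move=> a r b q ar bq; rewrite (le_trans (nrmD _ _))// lerD.
Qed.

Lemma cvg_nrmP (T : Type) (F : set_system T) (FF : Filter F) (u : T -> V) (l : V) :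
  u @ F --> l <-> forall e : R, 0 < e -> \forall t \near F, nrm (l - u t) < e.
Proof.
split=> [/cvgrPdist_lt ul e e0|H].
  have := ul e%:C%C; rewrite real_complex_gt0 => /(_ e0).
  by apply: filterS => t; rewrite normr_nrm ltcR.
apply/cvgrPdist_lt => e e0.
have re : e = (complex.Re e)%:C%C by rewrite RRe_real// gtr0_real.
have e1 : 0 < complex.Re e by move: e0; rewrite re real_complex_gt0.
by apply: filterS (H _ e1) => t; rewrite normr_nrm re ltcR.
Qed.

Lemma continuous_nrmP (g : R -> V) (t : R) :
  {for t, continuous g} <->
  forall e : R, 0 < e -> exists2 d : R, 0 < d &
    forall s, `|t - s| < d -> nrm (g t - g s) < e.
Proof.
split=> [/cvg_nrmP H e /H /nbhs_normP[d /= d0 Hd]|H].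
  by exists d => // s /Hd.
apply/cvg_nrmP => e /H[d d0 Hd]; apply/nbhs_normP; exists d => //= s /=; exact: Hd.
Qed.

End Basics.

Lemma nrmM (a b : C) : nrm (a * b : C^o) = nrm (a : C^o) * nrm (b : C^o).
Proof. exact: (@nrmZ C^o). Qed.

End RealNorm.

(** * Uniform continuity and boundedness on segments *)

Section UniformContinuity.
Variables (R : realType) (K : numFieldType) (V : normedModType K).

(** Heine-Cantor by a covering argument, with only [s] confined to the segment: [s'] may leave it,
    so shifted arguments need no enlarged segment. *)
Lemma segment_unif_continuous (g : R -> V) (a b : R) (e : K) :
  continuous g -> 0 < e ->
  exists2 d : R, 0 < d & forall s s', a <= s <= b -> `|s - s'| < d ->
    `|g s - g s'| < e.
Proof.
move=> cg e0.
have /compact_near_coveringP := @segment_compact R a b.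
move=> /(_ R ((0:R)^'+) (fun d s => forall s', `|s - s'| < d -> `|g s - g s'| < e)).
move=> /(_ (at_right_proper_filter 0)) cov.
have A : \forall d \near (0:R)^'+, [set` `[a, b]] `<=`
    (fun s => forall s', `|s - s'| < d -> `|g s - g s'| < e).
  apply: cov => x _.
  have e2 : 0 < e / 2 by rewrite divr_gt0.
  have /cvgrPdist_lt/(_ _ e2)/nbhs_normP[d /= d0 Hd] := cg x.
  (* [y] is within [d / 2] of [x] and [s'] within [d / 2] of [y], so both are within [d] of [x]. *)
  exists (ball x (d / 2), [set h | h < d / 2]).
    split; first by apply: nbhsx_ballx; rewrite divr_gt0.
    by apply: nbhs_right_lt; rewrite divr_gt0.
  case=> y h [/=]; rewrite -ball_normE /= => xy hd s' ys'.
  have -> : g y - g s' = - (g x - g y) + (g x - g s') by rewrite opprB addrA subrK.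
  rewrite (le_lt_trans (ler_normD _ _))// normrN [e]splitr ltrD//.
    by apply: Hd => /=; apply: (lt_trans xy); lra.
  apply: Hd => /=; rewrite -(subrKA y) (le_lt_trans (ler_normD _ _))// [d]splitr ltrD//.
  exact: lt_trans ys' hd.
have [d [Ad d0]] := filter_ex (filterI A (nbhs_right_gt (0 : R))).
by exists d => // s s' sab; apply: Ad; rewrite /= in_itv.
Qed.

End UniformContinuity.

Section Bounds.
Variables (R : realType).
Local Notation C := (complex R).
Variable V : normedModType C.

Lemma segment_unif_continuous_nrm (g : R -> V) (a b e : R) :
  continuous g -> 0 < e ->
  exists2 d : R, 0 < d & forall s s', a <= s <= b -> `|s - s'| < d ->
    nrm (g s - g s') < e.
Proof.
move=> cg e0; have e0' : (0 : C) < e%:C%C by rewrite real_complex_gt0.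
have [d d0 H] := segment_unif_continuous a b cg e0'.
by exists d => // s s' sab /(H _ _ sab); rewrite normr_nrm ltcR.
Qed.

Lemma nrm_continuous (g : R -> V) : continuous g -> continuous (fun s => nrm (g s)).
Proof.
move=> cg t; apply/cvgrPdist_lt => e e0.
have /cvg_nrmP/(_ _ e0) := cg t; apply: filterS => s; apply: le_lt_trans.
rewrite ler_norml lerBrDl lerBlDl; apply/andP; split.
  have := nrmD (g s - g t) (g t); rewrite subrK nrm_distC; lra.
have := nrmD (g t - g s) (g s); rewrite subrK; lra.
Qed.

Lemma segment_bounded (g : R -> V) (b : R) : continuous g ->
  exists2 M : R, 0 < M & forall s, 0 <= s <= b -> nrm (g s) <= M.
Proof.
move=> cg; have [b0|b0] := leP 0 b; last first.
  exists 1 => // s /andP[s0 sb].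
  by have := le_lt_trans (le_trans s0 sb) b0; rewrite ltxx.
have [|c _ H] := @EVT_max R (fun s => nrm (g s)) 0 b b0.
  by apply: continuous_subspaceT; exact: nrm_continuous.
exists (nrm (g c) + 1); first by rewrite ltr_wpDl// nrm_ge0.
by move=> s sb; rewrite ler_wpDr//; apply: H; rewrite in_itv.
Qed.

End Bounds.

Lemma cauchy_nrm_cvg (R : realType) (V : completeNormedModType (complex R))
    (u : nat -> V) :
  (forall e : R, 0 < e -> exists k, \forall m \near \oo, nrm (u k - u m) < e) ->
  cvg (u @ \oo).
Proof.
move=> ucauchy; apply: cauchy_cvg; apply: cauchy_exP => e e0.
have re : e = (complex.Re e)%:C%C by rewrite RRe_real// gtr0_real.
have r0 : 0 < complex.Re e by move: e0; rewrite re real_complex_gt0.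
have [k Hk] := ucauchy _ r0; exists (u k).
suff : \forall m \near \oo, ball (u k) e (u m) by [].
by apply: filterS Hk => m; rewrite -ball_normE /= normr_nrm re ltcR.
Qed.

Section LinearMaps.
Variables (R : realType) (V W : normedModType (complex R)) (T : V -> W).
Hypothesis T_lin : forall a x y, T (a *: x + y) = a *: T x + T y.

Lemma lin0 : T 0 = 0.
Proof. by have := T_lin (-1) 0 0; rewrite scaler0 addr0 scaleN1r addNr. Qed.

Lemma linD x y : T (x + y) = T x + T y.
Proof. by rewrite -[x]scale1r T_lin !scale1r. Qed.

Lemma linZ a x : T (a *: x) = a *: T x.
Proof. by have := T_lin a x 0; rewrite lin0 !addr0. Qed.

Lemma linB x y : T (x - y) = T x - T y.
Proof. by rewrite -(scaleN1r y) linD linZ scaleN1r. Qed.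

End LinearMaps.

(** * Left Riemann sums *)

Section RiemannSums.
Variable R : realType.
Local Notation C := (complex R).
Variable V : normedModType C.
Implicit Types (g h : R -> V) (t : R).

Lemma sample_itv t (n k : nat) : 0 <= t -> (k < n)%N -> 0 <= k%:R * t / n%:R <= t.
Proof.
move=> t0 kn; have n0 : (0 : R) < n%:R by rewrite ltr0n (leq_trans _ kn).
by rewrite divr_ge0 ?mulr_ge0 ?ler0n//= ler_pdivrMr// mulrC ler_wpM2l// ler_nat ltnW.
Qed.

Lemma sum_step t (n : nat) : (0 < n)%N -> \sum_(k < n) (t / n%:R) = t.
Proof.
by move=> n0; rewrite sumr_const card_ord -[LHS]mulr_natr divfK// pnatr_eq0 -lt0n.
Qed.

Lemma riemann_sum_nrm_le g (w : R -> R) t n : 0 <= t ->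
  (forall s, 0 <= s <= t -> nrm (g s) <= w s) ->
  nrm (riemann_sum g t n) <= \sum_(k < n) (t / n%:R) * w (k%:R * t / n%:R).
Proof.
move=> t0 gw; rewrite (le_trans (nrm_sum _ _ _))// ler_sum// => k _.
rewrite nrmZr ger0_norm ?divr_ge0 ?ler0n// ler_wpM2l ?divr_ge0 ?ler0n//.
by rewrite gw// sample_itv.
Qed.

Lemma riemann_sum_bound g t n M : 0 <= t -> 0 <= M ->
  (forall s, 0 <= s <= t -> nrm (g s) <= M) -> nrm (riemann_sum g t n) <= t * M.
Proof.
move=> t0 M0 gM; rewrite (le_trans (riemann_sum_nrm_le (w := fun=> M) _ t0 gM))//.
case: n => [|n]; first by rewrite big_ord0 mulr_ge0.
by rewrite -mulr_suml sum_step.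
Qed.

Lemma riemann_sum_linear (W : normedModType C) (T : V -> W) g t n :
  (forall a x y, T (a *: x + y) = a *: T x + T y) ->
  T (riemann_sum g t n) = riemann_sum (fun s => T (g s)) t n.
Proof.
move=> linT; rewrite /riemann_sum (big_morph T (linD linT) (lin0 linT)).
by apply: eq_bigr => k _; rewrite (linZ linT).
Qed.

Lemma riemann_sumD g h t n :
  riemann_sum (fun s => g s + h s) t n = riemann_sum g t n + riemann_sum h t n.
Proof. by rewrite -big_split/=; apply: eq_bigr => k _; rewrite scalerDr. Qed.

Lemma riemann_sum_eq g h t n : 0 <= t -> (forall s, 0 <= s <= t -> g s = h s) ->
  riemann_sum g t n = riemann_sum h t n.
Proof. by move=> t0 gh; apply: eq_bigr => k _; rewrite gh// sample_itv. Qed.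

Lemma riemann_sum_cst (c : V) t n : (0 < n)%N ->
  riemann_sum (fun=> c) t n = t%:C%C *: c.
Proof. by move=> n0; rewrite /riemann_sum -scaler_suml -rmorph_sum sum_step. Qed.

(** Reversing the index turns left sums into right sums, and the two differ by a single endpoint
    term. *)
Lemma riemann_sum_rev g t n : (0 < n)%N ->
  riemann_sum (fun s => g (t - s)) t n
  = riemann_sum g t n + (t / n%:R)%:C%C *: (g t - g 0).
Proof.
move=> n0; have nN0 : (n%:R : R) != 0 by rewrite pnatr_eq0 -lt0n.
have -> : riemann_sum (fun s => g (t - s)) t n =
    \sum_(k < n) (t / n%:R)%:C%C *: g (k.+1%:R * t / n%:R).
  rewrite /riemann_sum (reindex_inj rev_ord_inj)/=; apply: eq_bigr => k _.
  congr (_ *: g _); rewrite natrB//.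
  by field.
case: n n0 nN0 => // n _ nN0.
rewrite /riemann_sum big_ord_recr [in RHS]big_ord_recl/=.
rewrite mul0r mul0r mulrAC divff// mul1r scalerBr.
rewrite addrC [RHS]addrC -addrA [X in _ = _ + X]addrA addNr add0r.
by congr (_ + _); apply: eq_bigr => k _; rewrite /bump.
Qed.

(** Each fine node is within [t / n < d] of the coarse node opening its block. Two arbitrary numbers
    of steps are later compared through their product. *)
Lemma riemann_sum_refine g t (n m : nat) e d : 0 <= t -> (0 < n)%N -> (0 < m)%N ->
  (forall s s', 0 <= s <= t -> `|s - s'| < d -> nrm (g s - g s') < e) ->
  t < d * n%:R ->
  nrm (riemann_sum g t n - riemann_sum g t (n * m)) <= t * e.
Proof.
move=> t0 n0 m0 ud tdn.
have nN0 : (n%:R : R) != 0 by rewrite pnatr_eq0 -lt0n.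
have mN0 : (m%:R : R) != 0 by rewrite pnatr_eq0 -lt0n.
have nm0 : 0 <= t / (n * m)%:R by rewrite divr_ge0.
have -> : riemann_sum g t (n * m) = \sum_(i < n) \sum_(j < m)
    (t / (n * m)%:R)%:C%C *: g ((i * m + j)%:R * t / (n * m)%:R).
  rewrite /riemann_sum -(big_mkord xpredT (fun k =>
    (t / (n * m)%:R)%:C%C *: g (k%:R * t / (n * m)%:R))) big_nat_mul big_mkord.
  apply: eq_bigr => i _; rewrite -{1}[(i * m)%N]add0n big_addn mulSn addnK big_mkord.
  by apply: eq_bigr => j _; rewrite addnC.
have -> : riemann_sum g t n = \sum_(i < n) \sum_(j < m)
    (t / (n * m)%:R)%:C%C *: g (i%:R * t / n%:R).
  apply: eq_bigr => i _; rewrite -scaler_suml -rmorph_sum; congr (_%:C%C *: _).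
  by rewrite sumr_const card_ord -[RHS]mulr_natr natrM; field; rewrite nN0 mN0.
rewrite -sumrB (le_trans (nrm_sum _ _ _))//.
have -> : t * e = \sum_(i < n) \sum_(j < m) (t / (n * m)%:R * e).
  rewrite !sumr_const !card_ord -[RHS]mulr_natr -[X in _ = X * _]mulr_natr natrM.
  by field; rewrite nN0 mN0.
apply: ler_sum => i _; rewrite -sumrB (le_trans (nrm_sum _ _ _))//.
apply: ler_sum => j _; rewrite -scalerBr nrmZr ger0_norm// ler_wpM2l// ltW//.
apply: ud; first exact: sample_itv.
have -> : i%:R * t / n%:R - (i * m + j)%:R * t / (n * m)%:R
    = - (j%:R * t / m%:R / n%:R) :> R.
  by rewrite natrD !natrM; field; rewrite nN0 mN0.
have n0' : (0 : R) < n%:R by rewrite ltr0n.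
have /andP[j0 jt] := sample_itv t0 (ltn_ord j).
by rewrite normrN ger0_norm; [rewrite ltr_pdivrMr// (le_lt_trans jt)|rewrite divr_ge0].
Qed.

End RiemannSums.

(** * The integral over [0,t] as a limit of Riemann sums *)

Section Integral.
Variable R : realType.
Local Notation C := (complex R).

Section Complete.
Variable V : completeNormedModType C.
Implicit Types (g h : R -> V) (t : R).

Lemma integral_0t_unique (W : normedModType C) (g : R -> W) t l :
  riemann_sum g t @ \oo --> l -> integral_0t g t = l.
Proof. exact: (@cvg_lim W (@norm_hausdorff C W)). Qed.

Lemma riemann_sum_cvg g t : continuous g -> 0 <= t ->
  riemann_sum g t @ \oo --> integral_0t g t.
Proof.
move=> cg t0; suff : cvg (riemann_sum g t @ \oo) by [].
apply: cauchy_nrm_cvg => r r0.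
(* Two refinement errors, each [t] times this number, are added; with [t + 1] in the denominator the
   sum is strictly below [r], also for [t = 0]. *)
have e1 : 0 < r / (2 * (t + 1)) by rewrite divr_gt0// mulr_gt0//; lra.
have [d d0 ud] := segment_unif_continuous_nrm 0 t cg e1.
have [N [/= N0 Nt]] := filter_ex (filterI (nbhs_infty_gt 0) (nbhs_infty_gtr (t / d))).
have fine n : (0 < n)%N -> t / d < n%:R -> t < d * n%:R.
  by move=> _; rewrite ltr_pdivrMr// mulrC.
exists N; near=> n.
have n0 : (0 < n)%N by near: n; exact: nbhs_infty_gt.
have nt : t / d < n%:R by near: n; exact: nbhs_infty_gtr.
rewrite (le_lt_trans (nrm_triangle _ (riemann_sum g t (N * n)) _))//.
rewrite [X in _ + X]nrm_distC.
have H1 := riemann_sum_refine t0 N0 n0 ud (fine _ N0 Nt).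
have H2 := riemann_sum_refine t0 n0 N0 ud (fine _ n0 nt).
rewrite mulnC in H2.
apply: le_lt_trans (lerD H1 H2) _.
have -> : t * (r / (2 * (t + 1))) + t * (r / (2 * (t + 1))) = r * (t / (t + 1)).
  by field; rewrite gt_eqF//; lra.
by rewrite gtr_pMr// ltr_pdivrMr; lra.
Unshelve. all: by end_near. Qed.

(** Only samples in [0,t] occur, so both limits are taken of the same sequence; values outside the
    interval can be changed freely. *)
Lemma integral_0t_eq (W : normedModType C) (g h : R -> W) t : 0 <= t ->
  (forall s, 0 <= s <= t -> g s = h s) -> integral_0t g t = integral_0t h t.
Proof.
move=> t0 gh; rewrite /integral_0t; congr (lim (_ @ \oo)).
by apply/funext => n; exact: riemann_sum_eq.
Qed.

Lemma integral_0tD g h t : continuous g -> continuous h -> 0 <= t ->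
  integral_0t (fun s => g s + h s) t = integral_0t g t + integral_0t h t.
Proof.
move=> cg ch t0; apply: integral_0t_unique.
rewrite (_ : riemann_sum _ t = fun n => riemann_sum g t n + riemann_sum h t n).
  by apply: cvgD; exact: riemann_sum_cvg.
by apply/funext => n; exact: riemann_sumD.
Qed.

Lemma integral_0t_cst (W : normedModType C) (c : W) t : integral_0t (fun=> c) t = t%:C%C *: c.
Proof.
apply: integral_0t_unique; apply: cvg_near_cst; near=> n.
by apply: riemann_sum_cst; near: n; exact: nbhs_infty_gt.
Unshelve. all: by end_near. Qed.

Lemma integral_0t_linear (W : normedModType C) (T : V -> W) g t :
  (forall a x y, T (a *: x + y) = a *: T x + T y) -> continuous T ->
  continuous g -> 0 <= t ->
  T (integral_0t g t) = integral_0t (fun s => T (g s)) t.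
Proof.
move=> linT cT cg t0; apply/esym/integral_0t_unique.
rewrite (_ : riemann_sum _ t = T \o riemann_sum g t).
  by apply: cvg_comp; [exact: riemann_sum_cvg|exact: cT].
by apply/funext => n /=; rewrite (riemann_sum_linear _ _ _ linT).
Qed.

Lemma integral_0tZ (a : C) g t : continuous g -> 0 <= t ->
  integral_0t (fun s => a *: g s) t = a *: integral_0t g t.
Proof.
move=> cg t0; rewrite (integral_0t_linear (T := *:%R a))// => [b x y|].
  by rewrite scalerDr !scalerA mulrC.
exact: scaler_continuous.
Qed.

Lemma integral_0tB g h t : continuous g -> continuous h -> 0 <= t ->
  integral_0t (fun s => g s - h s) t = integral_0t g t - integral_0t h t.
Proof.
move=> cg ch t0; rewrite integral_0tD// => [|s]; last by apply: cvgN; exact: ch.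
congr (_ + _); rewrite -scaleN1r -integral_0tZ//.
by congr (integral_0t _ t); apply/funext => s; rewrite scaleN1r.
Qed.

Lemma integral_0t_bound g t M : continuous g -> 0 <= t -> 0 <= M ->
  (forall s, 0 <= s <= t -> nrm (g s) <= M) -> nrm (integral_0t g t) <= t * M.
Proof.
move=> cg t0 M0 gM; apply/ler_addgt0Pr => e e0.
have /cvg_nrmP/(_ _ e0) := riemann_sum_cvg cg t0.
move=> /filter_ex[n] H.
have := nrmD (integral_0t g t - riemann_sum g t n) (riemann_sum g t n).
rewrite subrK => /le_trans; apply.
by rewrite addrC lerD// ?(ltW H)// riemann_sum_bound.
Qed.

Lemma integral_0t_rev g t : continuous g -> 0 <= t ->
  integral_0t (fun s => g (t - s)) t = integral_0t g t.
Proof.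
move=> cg t0; apply: integral_0t_unique.
have zero : (fun n : nat => (t / n%:R)%:C%C *: (g t - g 0)) @ \oo --> (0 : V).
  apply/cvg_nrmP => e e0; near=> n.
  have n0 : 0 < n%:R :> R by rewrite ltr0n; near: n; exact: nbhs_infty_gt.
  rewrite sub0r nrmN nrmZr ger0_norm ?divr_ge0// mulrAC ltr_pdivrMr//.
  by rewrite [e * _]mulrC -ltr_pdivrMr//; near: n; exact: nbhs_infty_gtr.
have : (fun n => riemann_sum g t n + (t / n%:R)%:C%C *: (g t - g 0)) @ \oo
    --> integral_0t g t + 0 by apply: cvgD zero; exact: riemann_sum_cvg.
rewrite addr0 => /cvg_nrmP H.
apply/cvg_nrmP => e /H; apply: filterS2 (nbhs_infty_gt 0) => n n0.
by rewrite riemann_sum_rev.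
Unshelve. all: by end_near. Qed.

End Complete.
End Integral.

(** * Riemann sums of real functions and primitives *)

Section RealPrimitive.
Variable R : realType.

Lemma continuous_primitive (phi : R -> R) : continuous phi ->
  exists Phi : R -> R, forall s : R, 0 <= s -> is_derive s (1 : R) Phi (phi s).
Proof.
move=> cphi.
(* Starting at [-1] keeps every [s >= 0] away from the lower end, so the derivative is two-sided
   even at 0. *)
exists (fun y => (\int[lebesgue_measure]_(t in [set` `[(-1 : R), y]]) (phi t))%R) => s s0.
have int1 : lebesgue_measure.-integrable `[(-1 : R), s + 1] (EFin \o phi).
  apply: continuous_compact_integrable; first exact: segment_compact.
  exact: continuous_subspaceT.
have s1 : s < s + 1 by lra.
have s2 : -1 < s by lra.
have [d1 d2] := continuous_FTC1_closed s1 int1 s2 (cphi s).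
apply: DeriveDef; first exact: d1.
by rewrite -derive1E.
Qed.

(** [Phi] is chosen before [a] and [b], so additivity over adjacent intervals becomes a cancellation
    of values of [Phi]. Each mesh interval is handled by the mean value theorem. *)
Lemma riemann_sum_primitive (phi : R -> R) : continuous phi ->
  exists Phi : R -> R, forall a b, 0 <= a -> 0 <= b ->
    (fun n => \sum_(k < n) (b / n%:R) * phi (a + k%:R * b / n%:R)) @ \oo
      --> Phi (a + b) - Phi a.
Proof.
move=> cphi; have [Phi dPhi] := continuous_primitive cphi.
exists Phi => a b a0 b0; apply/cvgrPdist_lt => e e0.
have e1 : 0 < e / (b + 1) by rewrite divr_gt0//; lra.
have [d d0 ud] := segment_unif_continuous a (a + b) cphi e1.
near=> n.
have n0 : 0 < n%:R :> R by rewrite ltr0n; near: n; exact: nbhs_infty_gt.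
have bn : b / n%:R < d.
  rewrite ltr_pdivrMr// mulrC -ltr_pdivrMr//; near: n; exact: nbhs_infty_gtr.
have bn0 : 0 <= b / n%:R by rewrite divr_ge0// ltW.
have nN0 : n%:R != 0 :> R by rewrite gt_eqF.
pose p k := a + k%:R * b / n%:R.
have -> : Phi (a + b) - Phi a = \sum_(k < n) (Phi (p k.+1) - Phi (p k)).
  rewrite -(big_mkord xpredT (fun k => Phi (p k.+1) - Phi (p k))) telescope_sumr//.
  by rewrite /p mul0r mul0r addr0 mulrAC divff// mul1r.
rewrite -sumrB (le_lt_trans (ler_norm_sum _ _ _))//.
(* The summand [e / (b + 1)] outside the sum is the slack that makes the final inequality strict. *)
have -> : e = e / (b + 1) + \sum_(k < n) (b / n%:R * (e / (b + 1))).
  rewrite -mulr_suml sum_step ?(ltr0n R)//; last by rewrite -(ltr0n R).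
  by field; rewrite gt_eqF//; lra.
rewrite ltr_pwDl// ler_sum// => k _.
have pS : p k.+1 = p k + b / n%:R by rewrite /p -natr1; field.
have pk0 : a <= p k by rewrite /p lerDl divr_ge0 ?mulr_ge0// ltW.
have pkb : p k <= a + b.
  by rewrite /p lerD2l; have /andP[] := sample_itv b0 (ltn_ord k).
have [|||c] := @MVT_segment R Phi phi (p k) (p k.+1).
- by rewrite pS lerDl.
- by move=> x; rewrite in_itv/= => /andP[px _]; apply: dPhi; lra.
- apply: derivable_within_continuous => x; rewrite in_itv/= => /andP[px _].
  have x0 : 0 <= x by lra.
  exact: (@ex_derive _ _ _ _ _ _ _ (dPhi x x0)).
rewrite in_itv/= pS => /andP[c1 c2 ->].
have -> : phi c * (p k + b / n%:R - p k) - b / n%:R * phi (p k)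
   = b / n%:R * - (phi (p k) - phi c) by ring.
rewrite normrM ger0_norm// ler_wpM2l// normrN ltW// ud ?pk0//.
by rewrite distrC ger0_norm; lra.
Unshelve. all: by end_near. Qed.

End RealPrimitive.

(** * Inner product, and additivity of the integral over intervals *)

Section InnerProduct.
Variable R : realType.
Local Notation C := (complex R).
Variable H : completeNormedModType C.
Variable ip : H -> H -> C.
Hypothesis ip_linl :
  forall (a : C) (x y v : H), ip (a *: x + y) v = a * ip x v + ip y v.
Hypothesis ip_sym : forall x y : H, ip y x = conjc (ip x y).
Hypothesis ip_norm : forall x : H, ip x x = `|x| ^+ 2.

Lemma ipDl x y v : ip (x + y) v = ip x v + ip y v.
Proof. by rewrite -[x]scale1r ip_linl mul1r scale1r. Qed.

Lemma ip0l v : ip 0 v = 0.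
Proof. by have := ip_linl (-1) 0 0 v; rewrite scaler0 addr0 mulN1r addNr. Qed.

Lemma ipZl a x v : ip (a *: x) v = a * ip x v.
Proof. by have := ip_linl a x 0 v; rewrite ip0l !addr0. Qed.

Lemma ipNl x v : ip (- x) v = - ip x v.
Proof. by rewrite -scaleN1r ipZl mulN1r. Qed.

Lemma ipBl x y v : ip (x - y) v = ip x v - ip y v.
Proof. by rewrite ipDl ipNl. Qed.

Lemma ipBr x y v : ip v (x - y) = ip v x - ip v y.
Proof. by rewrite ip_sym ipBl rmorphB/= -!ip_sym. Qed.

Lemma ipZr a x v : ip v (a *: x) = conjc a * ip v x.
Proof. by rewrite ip_sym ipZl rmorphM/= -!ip_sym. Qed.

Lemma ip_eq0 x : ip x x = 0 -> x = 0.
Proof. by rewrite ip_norm => /eqP; rewrite expf_eq0/= normr_eq0 => /eqP. Qed.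

Lemma cauchy_schwarz x y : nrm (ip x y : C^o) <= nrm x * nrm y.
Proof.
have [->|y0] := eqVneq y 0.
  by rewrite ip_sym ip0l conjc0 !nrm0 mulr0.
have yy0 : ip y y != 0 by apply: contra_neq y0 => /ip_eq0.
pose c := ip x y / ip y y.
have E : ip (x - c *: y) (x - c *: y) = ip x x - ip x y * conjc (ip x y) / ip y y.
  rewrite ipBr !ipBl !ipZr !ipZl (ip_sym x y) /c rmorphM/= conjc_inv -(ip_sym y y).
  by field.
have : 0 <= ip (x - c *: y) (x - c *: y) by rewrite ip_norm exprn_ge0.
rewrite E subr_ge0 -sqr_normc !ip_norm ler_pdivrMr; last first.
  by rewrite exprn_gt0// normr_gt0.
rewrite -exprMn ler_pXn2r ?nnegrE ?mulr_ge0//.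
by move=> h; rewrite -lecR rmorphM/= -!normr_nrm.
Qed.

Lemma ip_continuous v : continuous (ip ^~ v : H -> C^o).
Proof.
move=> x; apply/cvg_nrmP => e e0.
have v1 : 0 < nrm v + 1 by rewrite ltr_wpDl// nrm_ge0.
have /(@cvg_nrmP _ H)/(_ (e / (nrm v + 1))) := @cvg_id _ (nbhs x).
rewrite divr_gt0// => /(_ isT); apply: filterS => y xy.
rewrite -ipBl (le_lt_trans (cauchy_schwarz _ _))//.
rewrite (@le_lt_trans _ _ (nrm (x - y) * (nrm v + 1)))//.
  by rewrite ler_wpM2l ?nrm_ge0// lerDl.
by rewrite -ltr_pdivlMr.
Qed.

Lemma cvg_ip (T : Type) (F : set_system T) (u : T -> H) l v : Filter F ->
  u @ F --> l -> (fun s => ip (u s) v : C^o) @ F --> (ip l v : C^o).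
Proof. by move=> FF ul; exact: (cvg_comp _ _ ul (@ip_continuous v l)). Qed.

Lemma ip_integral_0t (g : R -> H) v t : continuous g -> 0 <= t ->
  ip (integral_0t g t) v = integral_0t (fun s => ip (g s) v : C^o) t.
Proof.
move=> cg t0.
have iplin a x y : ip (a *: x + y) v = a *: (ip x v : C^o) + ip y v by rewrite ip_linl.
exact: (integral_0t_linear (W := C^o) iplin (@ip_continuous v) cg t0).
Qed.

Lemma Re_nrm_le (a : C) : `|complex.Re a| <= nrm (a : C^o).
Proof. by rewrite -lecR -(@normr_nrm _ C^o) normc_ge_Re. Qed.

Lemma Re_ip_continuous (g : R -> H) v : continuous g ->
  continuous (fun s => complex.Re (ip (g s) v)).
Proof.
move=> cg t; apply/cvgrPdist_lt => e e0.
have : (fun s => ip (g s) v : C^o) @ t --> (ip (g t) v : C^o).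
  by apply: cvg_ip; exact: cg.
move=> /(@cvg_nrmP _ C^o)/(_ _ e0); apply: filterS => s.
by apply: le_lt_trans; rewrite -raddfB/=; exact: Re_nrm_le.
Qed.

(* The left Riemann sums of two adjacent intervals have incommensurable steps;
   pairing with a vector reduces additivity to the real fundamental theorem. *)
Lemma Re_ip_integral_0t (g : R -> H) v : continuous g ->
  exists Phi : R -> R, forall a b, 0 <= a -> 0 <= b ->
    complex.Re (ip (integral_0t (fun s => g (a + s)) b) v) = Phi (a + b) - Phi a.
Proof.
move=> cg.
have [Phi HPhi] := riemann_sum_primitive (Re_ip_continuous (v := v) cg).
exists Phi => a b a0 b0.
have cga : continuous (fun s => g (a + s)).
  by move=> s; apply: continuous_comp; [exact: cvgD (cvg_cst _) cvg_id|exact: cg].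
have := HPhi a b a0 b0.
have E n : \sum_(k < n) b / n%:R * complex.Re (ip (g (a + k%:R * b / n%:R)) v)
    = complex.Re (ip (riemann_sum (fun s => g (a + s)) b n) v).
  rewrite /riemann_sum; elim/big_ind2 : _ => [||k _].
  - by rewrite ip0l.
  - by move=> x1 x2 y1 y2 -> ->; rewrite ipDl raddfD.
  by rewrite ipZl; case: (ip _ _) => p q /=; rewrite mul0r subr0.
move=> lim1.
have lim2 : (fun n => complex.Re (ip (riemann_sum (fun s => g (a + s)) b n) v)) @ \oo
    --> complex.Re (ip (integral_0t (fun s => g (a + s)) b) v).
  apply/cvgrPdist_lt => e e0.
  have : (fun n => ip (riemann_sum (fun s => g (a + s)) b n) v : C^o) @ \oo
      --> (ip (integral_0t (fun s => g (a + s)) b) v : C^o).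
    by apply: cvg_ip; exact: riemann_sum_cvg.
  move=> /(@cvg_nrmP _ C^o)/(_ _ e0); apply: filterS => s.
  by apply: le_lt_trans; rewrite -raddfB/=; exact: Re_nrm_le.
rewrite -(cvg_lim (@Rhausdorff R) lim1) -(cvg_lim (@Rhausdorff R) lim2).
by congr (lim (_ @ \oo)); apply/funext => n; rewrite E.
Qed.

(** The defect [v] of additivity is paired with itself: the real parts are differences of values of
    one [Phi], so (v, v), which is real, vanishes. *)
Lemma integral_0t_chasles (g : R -> H) a b : continuous g -> 0 <= a -> 0 <= b ->
  integral_0t g (a + b) = integral_0t g a + integral_0t (fun s => g (a + s)) b.
Proof.
move=> cg a0 b0; apply/eqP; rewrite -subr_eq0; apply/eqP/ip_eq0.
set v := (X in ip _ X).
have [Phi HPhi] := Re_ip_integral_0t v cg.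
have re0 c : 0 <= c -> complex.Re (ip (integral_0t g c) v) = Phi c - Phi 0.
  move=> c0; have := HPhi 0 c (lexx _) c0; rewrite add0r => <-.
  by congr (complex.Re (ip (integral_0t _ _) v)); apply/funext => s; rewrite add0r.
have im0 : ip v v = (complex.Re (ip v v))%:C%C.
  by rewrite RRe_real// ip_norm ger0_real// exprn_ge0.
rewrite im0; suff -> : complex.Re (ip v v) = 0 by [].
by rewrite {1}/v ipBl ipDl !raddfB !raddfD/= !re0 ?addr_ge0// HPhi//; ring.
Qed.

End InnerProduct.

(** * Uniform boundedness principle *)

Section Resonance.
Variable R : realType.
Local Notation C := (complex R).

Section OperatorNorm.
Variables V W : normedModType C.
Variable T : V -> W.
Hypothesis T_lin : forall a x y, T (a *: x + y) = a *: T x + T y.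

Hypothesis T_cont : continuous T.

(** [b] is the operator norm, a supremum over the unit ball; the last clause, almost attainment,
    provides the directions [xi] in [resonance]. *)
Lemma opnorm_exists : exists b : R,
  [/\ 0 <= b, forall x, nrm (T x) <= b * nrm x &
      forall c, c < b -> exists2 x, nrm x <= 1 & c < nrm (T x)].
Proof.
have [d d0 Hd] : exists2 d : R, 0 < d & forall x, nrm x < d -> nrm (T x) < 1.
  have /(@cvg_nrmP _ W)/(_ _ ltr01)/nbhs_normP[e /= e0 He] := @T_cont 0.
  have re : e = (complex.Re e)%:C%C by rewrite RRe_real// gtr0_real.
  exists (complex.Re e); first by move: e0; rewrite re real_complex_gt0.
  move=> x xe; have := He x; rewrite /= sub0r normrN normr_nrm re ltcR => /(_ xe).
  by rewrite (lin0 T_lin) sub0r nrmN.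
pose E := [set r | exists2 x, nrm x <= 1 & r = nrm (T x)].
have hE : has_sup E.
  split; first by exists (nrm (T 0)); exists 0 => //; rewrite nrm0.
  exists (2 / d) => _ [x x1 ->].
  have : nrm (T ((d / 2)%:C%C *: x)) < 1.
    apply: Hd; rewrite nrmZr gtr0_norm ?divr_gt0//.
    rewrite (@le_lt_trans _ _ (d / 2))//; last by lra.
    by rewrite ler_piMr// divr_ge0// ltW.
  rewrite (linZ T_lin) nrmZr gtr0_norm ?divr_gt0// => /ltW.
  by rewrite mulrC -ler_pdivlMr ?divr_gt0// invf_div mul1r.
exists (sup E); split.
- have : E (nrm (T 0)) by exists 0 => //; rewrite nrm0.
  by move/(ub_le_sup hE.2); apply: le_trans; exact: nrm_ge0.
- move=> x; have [x0|x0] := eqVneq (nrm x) 0.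
    by rewrite (nrm0_eq0 x0) (lin0 T_lin) !nrm0 mulr0.
  have xp : 0 < nrm x by rewrite lt_neqAle eq_sym x0 nrm_ge0.
  rewrite -ler_pdivrMr//; apply: (ub_le_sup hE.2).
  exists ((nrm x)^-1%:C%C *: x).
    by rewrite nrmZr gtr0_norm ?invr_gt0// mulVf.
  by rewrite (linZ T_lin) nrmZr gtr0_norm ?invr_gt0// mulrC.
- move=> c cb; have cb0 : 0 < sup E - c by rewrite subr_gt0.
  have [_ [x x1 ->]] := sup_adherent cb0 hE.
  by rewrite opprB addrC subrK => cx; exists x.
Qed.

End OperatorNorm.

(* Sokal's proof of the uniform boundedness principle: among x + xi and x - xi,
   one has an image of norm at least that of the image of xi. *)
Lemma resonance (V : completeNormedModType C) (W : normedModType C)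
    (T : nat -> V -> W) :
  (forall n a x y, T n (a *: x + y) = a *: T n x + T n y) ->
  (forall n, continuous (T n)) ->
  (forall n, exists x, n%:R * nrm x < nrm (T n x)) ->
  exists x, forall M N, exists2 n, (N <= n)%N & M < nrm (T n x).
Proof.
move=> T_lin T_cont T_big.
pose q : R := 3^-1.
have q0 k : 0 < q ^+ k by rewrite exprn_gt0// invr_gt0.
(* Since [b (nk k) > nk k], one has [b (nk k) * q ^+ k > 12 (k + 1)]. Passing to the limit [x] costs
   at most half of [b (nk k) * q ^+ k] out of the guaranteed two thirds, and the remaining sixth
   exceeds [2 (k + 1)]. *)
pose nk k := (12 * k.+1 * 3 ^ k)%N.
have kn k : (k <= nk k)%N.
  rewrite /nk -mulnA mulnC -mulnA (leq_trans (leqnSn k))// leq_pmulr// muln_gt0.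
  by rewrite expn_gt0.
have [b Hb] := choice (fun n => opnorm_exists (@T_lin n) (@T_cont n)).
have nb n : n%:R < b n.
  have [x nx] := T_big n; have [b0 bT _] := Hb n.
  rewrite ltNge; apply/negP => bn.
  have := ler_wpM2r (nrm_ge0 x) bn; have := bT x; lra.
have /choice[xi Hxi] k : exists x : V, nrm x <= 1 /\ 2 / 3 * b (nk k) < nrm (T (nk k) x).
  have [b0 _ Hx] := Hb (nk k).
  have bp : 0 < b (nk k) by rewrite (le_lt_trans _ (nb _)).
  by have [|x ? ?] := Hx (2 / 3 * b (nk k)); [lra|exists x].
pose step k x := let y := (q ^+ k)%:C%C *: xi k in
  if nrm (T (nk k) y) <= nrm (T (nk k) (x + y)) then x + y else x - y.
pose fix X k := if k is k'.+1 then step k' (X k') else 0.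
have stepE k : nrm (X k.+1 - X k) <= q ^+ k.
  have H y : y = (q ^+ k)%:C%C *: xi k -> nrm y <= q ^+ k.
    by move=> ->; rewrite nrmZr gtr0_norm// ler_piMr ?(ltW (q0 _))// (Hxi k).1.
  rewrite /= /step; case: ifP => _.
    by rewrite addrC addKr H.
  by rewrite addrC addKr nrmN H.
have big k : 2 / 3 * b (nk k) * q ^+ k <= nrm (T (nk k) (X k.+1)).
  have H : 2 / 3 * b (nk k) * q ^+ k <= nrm (T (nk k) ((q ^+ k)%:C%C *: xi k)).
    rewrite (linZ (@T_lin _)) nrmZr gtr0_norm// mulrC ler_wpM2l ?(ltW (q0 _))//.
    exact/ltW/(Hxi k).2.
  rewrite /= /step; case: ifP => [/(le_trans H)//|/negbT]; rewrite -ltNge => lt1.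
  rewrite (le_trans H)//; set y := _ *: xi k in lt1 *; set x := X k in lt1 *.
  (* [2 T y = T (x + y) - T (x - y)]: if the image of [x + y] is smaller than that of [y], the image
     of [x - y] makes up for it. *)
  have E : T (nk k) y + T (nk k) y = T (nk k) (x + y) - T (nk k) (x - y).
    rewrite -(linB (@T_lin _)) -(linD (@T_lin _)); congr (T _ _).
    by rewrite opprB addrCA [x + y]addrC addrK.
  have := nrmB (T (nk k) (x + y)) (T (nk k) (x - y)); rewrite -E.
  rewrite -[in X in X -> _](scale1r (T (nk k) y)) -scalerDl.
  have -> : (1 + 1 : C) = (2 : R)%:C%C by rewrite -[1 + 1]/(2%:R : C) rmorph_nat.
  by rewrite nrmZr ger0_norm//; lra.
(* The exact geometric sum, rather than its bound [3 / 2 * q ^+ k], is what the induction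
   carries. *)
have tail k m : nrm (X (m + k)%N - X k) <= 3 / 2 * (q ^+ k - q ^+ (m + k)).
  elim: m => [|m IH]; first by rewrite add0n !subrr nrm0 mulr0.
  rewrite addSn (le_trans (nrm_triangle _ (X (m + k)%N) _))//.
  have := stepE (m + k)%N; rewrite exprS /q; have := IH; rewrite /q; lra.
have tail' k m : (k <= m)%N -> nrm (X m - X k) <= 3 / 2 * q ^+ k.
  move=> km; have := tail k (m - k)%N; rewrite subnK//; have := q0 m; lra.
have qlim : (fun k => q ^+ k) @ \oo --> (0 : R).
  by apply: cvg_expr; rewrite /q gtr0_norm ?invr_gt0// invf_lt1// ltr1n.
have cX : cvg (X @ \oo).
  apply: cauchy_nrm_cvg => e e0; have r0 : 0 < e / 2 by lra.
  have /cvgrPdist_lt/(_ _ r0)/filter_ex[k] := qlim.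
  rewrite sub0r normrN gtr0_norm// => qk.
  exists k; near=> m; rewrite nrm_distC.
  have km : (k <= m)%N by near: m; exact: nbhs_infty_ge.
  have := tail' k m km; lra.
exists (lim (X @ \oo)) => M N; set x := lim _.
have xk k : nrm (x - X k) <= 3 / 2 * q ^+ k.
  apply/ler_addgt0Pr => e e0.
  have [m [/= km xm]] := filter_ex (filterI (nbhs_infty_ge k) (iffLR (cvg_nrmP _ _ _) cX _ e0)).
  have := nrm_triangle x (X m) (X k); have := tail' k m km.
  rewrite /x in xm *; lra.
have [k [/= Nk Mk]] := filter_ex (filterI (nbhs_infty_ge N) (nbhs_infty_gtr M)).
exists (nk k); first exact: leq_trans Nk (kn k).
have [_ bT _] := Hb (nk k).
have B1 := big k.
have B2 := bT (X k.+1 - x).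
rewrite nrm_distC in B2; rewrite (linB (@T_lin _)) in B2.
have B3 := nrmD (T (nk k) (X k.+1) - T (nk k) x) (T (nk k) x).
rewrite subrK in B3.
have B4 := xk k.+1.
have B0 : 0 < b (nk k) by rewrite (le_lt_trans _ (nb _)).
have B5 : b (nk k) * nrm (x - X k.+1) <= b (nk k) * (q ^+ k / 2).
  rewrite ler_wpM2l ?(ltW B0)// (le_trans B4)// exprS /q; lra.
have B6 : 12 * k.+1%:R < b (nk k) * q ^+ k.
  have -> : 12 * k.+1%:R = (nk k)%:R * q ^+ k :> R.
    by rewrite /nk !natrM natrX -mulrA -exprMn divff// expr1n mulr1.
  by rewrite ltr_pM2r.
have B7 : (k%:R : R) <= k.+1%:R by rewrite ler_nat.
have B8 : (0 : R) <= k%:R by [].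
lra.
Unshelve. all: by end_near. Qed.

End Resonance.

(** To the left of [t] the base point is the moving point [s], not [t]; hence the right modulus has
    to be uniform in [r] on bounded intervals. *)
Lemma continuous_max0 (R : realType) (V : normedModType (complex R)) (F : R -> V) :
  (forall b e : R, 0 < e -> exists2 d : R, 0 < d &
    forall r h, 0 <= r <= b -> 0 <= h < d -> nrm (F r - F (r + h)) < e) ->
  continuous (fun t : R => F (Num.max 0 t)).
Proof.
move=> HF t; apply/continuous_nrmP => e e0.
have [d d0 Hd] := HF (Num.max 0 t) e e0.
exists d => // s sd.
have [ts|ts] := leP t s.
  have mm : Num.max 0 t <= Num.max 0 s by rewrite ge_max !le_max lexx ts orbT.
  rewrite -(subrKC (Num.max 0 t) (Num.max 0 s)).
  apply: Hd; first by rewrite le_max !lexx.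
  rewrite subr_ge0 mm/=; apply: le_lt_trans sd.
  by rewrite distrC ger0_norm ?subr_ge0// /Num.max; case: ltP => ?; case: ltP => ?; lra.
have mm : Num.max 0 s <= Num.max 0 t by rewrite ge_max !le_max lexx (ltW ts) orbT.
rewrite nrm_distC -(subrKC (Num.max 0 s) (Num.max 0 t)).
apply: Hd; first by rewrite le_max lexx.
rewrite subr_ge0 mm/=; apply: le_lt_trans sd.
by rewrite ger0_norm ?subr_ge0 ?(ltW ts)// /Num.max; case: ltP => ?; case: ltP => ?; lra.
Qed.

(** * Local boundedness of the semigroup and continuity of orbits *)

Section Semigroup.
Variable R : realType.
Local Notation C := (complex R).
Variable H : completeNormedModType C.
Variable U : R -> H -> H.
Hypothesis U_lin : forall t (a : C) (x y : H), 0 <= t ->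
  U t (a *: x + y) = a *: U t x + U t y.
Hypothesis U_cont : forall t, 0 <= t -> continuous (U t).
Hypothesis U0 : forall x, U 0 x = x.
Hypothesis U_semi : forall t s x, 0 <= t -> 0 <= s -> U (t + s) x = U t (U s x).
Hypothesis U_strong : forall x, U t x @[t --> 0^'+] --> x.

Lemma strong_at0 x (e : R) : 0 < e ->
  exists2 d : R, 0 < d & forall t, 0 <= t < d -> nrm (x - U t x) < e.
Proof.
move=> e0; have /(@cvg_nrmP _ H)/(_ _ e0)[d /= d0 Hd] := @U_strong x.
exists d => // t /andP[t0 td]; move: t0; rewrite le_eqVlt => /predU1P[<-|t0].
  by rewrite U0 subrr nrm0.
by apply: Hd => //=; rewrite sub0r normrN gtr0_norm.
Qed.

(** Otherwise there are times [t_n <= 1 / (n + 1)] with [U t_n] of norm above [n + 1]; by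
    [resonance] some [U t_n x] is unbounded in [n], although it tends to [x]. *)
Lemma semigroup_bounded_at0 : exists d M : R, [/\ 0 < d, 1 <= M &
  forall t x, 0 <= t <= d -> nrm (U t x) <= M * nrm x].
Proof.
apply: contrapT => nH.
have /choice[tx Htx] n : exists p : R * H,
    0 <= p.1 <= n.+1%:R^-1 /\ n.+1%:R * nrm p.2 < nrm (U p.1 p.2).
  apply: contrapT => nE; apply: nH; exists n.+1%:R^-1, n.+1%:R; split.
  - by rewrite invr_gt0.
  - by rewrite ler1n.
  move=> t x tn; rewrite leNgt; apply/negP => big; apply: nE.
  by exists (t, x).
pose T n := U (tx n).1.
have t0 n : 0 <= (tx n).1 by have [/andP[]] := Htx n.
have [||n|x Hx] := @resonance R H H T.
- by move=> n a x y; exact: U_lin.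
- by move=> n; exact: U_cont.
- exists (tx n).2; have [_] := Htx n; apply: le_lt_trans.
  by rewrite ler_wpM2r ?nrm_ge0// ler_nat.
have [d d0 Hd] := strong_at0 x ltr01.
have [N /= NdN] := filter_ex (nbhs_infty_gtr d^-1).
have [n Nn] := Hx (nrm x + 1) N; rewrite ltNge => /negP; apply.
have -> : T n x = x - (x - T n x) by rewrite subKr.
rewrite (le_trans (nrmB _ _))// lerD2l ltW// Hd// t0/=.
have [/andP[_ tn] _] := Htx n; rewrite (le_lt_trans tn)//.
rewrite -[ltRHS]invrK ltf_pV2 ?posrE ?invr_gt0// (lt_le_trans NdN)// ler_nat.
exact: leq_trans Nn (leqnSn n).
Qed.

(** A time up to [(n + 1) d] is cut into steps of length at most [d], each costing a factor [M]. *)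
Lemma semigroup_bounded b : exists2 K : R, 0 < K &
  forall t x, 0 <= t <= b -> nrm (U t x) <= K * nrm x.
Proof.
have [d [M [d0 M1 HM]]] := semigroup_bounded_at0.
have M0 : 0 <= M by rewrite (le_trans _ M1).
have Hn n t x : 0 <= t <= n.+1%:R * d -> nrm (U t x) <= M ^+ n.+1 * nrm x.
  elim: n t x => [|n IH] t x /andP[t0 tn]; first by rewrite HM// t0 -[d]mul1r.
  have [td|td] := leP t d.
    rewrite (le_trans (HM t x _)) ?t0//.
    by rewrite ler_wpM2r ?nrm_ge0// exprS ler_peMr// exprn_ege1.
  have td0 : 0 <= t - d by lra.
  rewrite -(subrKC d t) U_semi// ?(ltW d0)// (le_trans (HM _ _ _)) ?(ltW d0) ?lexx//.
  rewrite exprS -mulrA ler_wpM2l// IH// td0/=.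
  by move: tn; rewrite -natr1; lra.
have [n /= nb] := filter_ex (nbhs_infty_gtr (b / d)).
exists (M ^+ n.+1); first by rewrite exprn_gt0// (lt_le_trans _ M1).
move=> t x /andP[t0 tb]; apply: Hn; rewrite t0 (le_trans tb)//.
move: nb; rewrite ltr_pdivrMr// -natr1 => nb; lra.
Qed.

(** [U r x - U (r + h) x = U r (x - U h x)], with [U r] bounded uniformly for [r] in a segment. *)
Lemma orbit_continuous x : continuous (fun t : R => U (Num.max 0 t) x).
Proof.
apply: (@continuous_max0 R H (U ^~ x)) => b e e0.
have [K K0 HK] := semigroup_bounded b.
have eK : 0 < e / K by rewrite divr_gt0.
have [d d0 Hd] := strong_at0 x eK.
exists d => // r h rb hd; have /andP[r0 _] := rb; have /andP[h0 _] := hd.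
rewrite U_semi// -(linB (fun a y z => U_lin a y z r0)) (le_lt_trans (HK _ _ rb))//.
by rewrite mulrC -ltr_pdivlMr// Hd.
Qed.

End Semigroup.

(** * Gronwall's lemma *)

Section Gronwall.
Variable R : realType.
Local Notation C := (complex R).

(** A left sum of an increasing function stays below its integral: each term is at most an increment
    of [expR (l * s) / l], by [1 + l r <= expR (l r)], and the increments telescope. *)
Lemma expR_riemann_sum_le (l t : R) n : 0 < l -> 0 <= t ->
  \sum_(k < n) (t / n%:R) * expR (l * (k%:R * t / n%:R)) <= expR (l * t) / l.
Proof.
move=> l0 t0; case: n => [|n]; first by rewrite big_ord0 divr_ge0 ?expR_ge0// ltW.
pose p k := expR (l * (k%:R * t / n.+1%:R)) / l.
have n0 : (0 : R) < n.+1%:R by rewrite ltr0n.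
apply: (@le_trans _ _ (\sum_(k < n.+1) (p k.+1 - p k))).
  apply: ler_sum => k _; rewrite /p.
  have -> : l * (k.+1%:R * t / n.+1%:R)
      = l * (k%:R * t / n.+1%:R) + l * (t / n.+1%:R).
    by rewrite -[k.+1%:R]natr1; field; rewrite gt_eqF.
  rewrite expRD -mulrBl ler_pdivlMr//.
  set E := expR (l * (k%:R * t / n.+1%:R)); set r := t / n.+1%:R.
  have -> : r * E * l = E * (1 + l * r) - E by ring.
  by rewrite lerD2r ler_wpM2l ?expR_ge0// expR_ge1Dx.
rewrite -(big_mkord xpredT (fun k => p k.+1 - p k)) telescope_sumr//.
rewrite /p [_ * t / _]mulrAC divff ?gt_eqF// mul1r lerBlDr lerDl.
by rewrite divr_ge0 ?expR_ge0// ltW.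
Qed.

(* Gronwall: with the weight [expR (l * t)], [l = 2 (c + 1)], the hypothesis halves
   every bound of [T (v t)]. *)
Lemma gronwall_eq0 (V : completeNormedModType C) (W : normedModType C)
    (T : V -> W) (v : R -> V) (c b : R) :
  (forall a x y, T (a *: x + y) = a *: T x + T y) -> continuous T ->
  continuous v -> 0 <= c ->
  (forall t, 0 <= t <= b -> nrm (T (v t)) <= c * nrm (T (integral_0t v t))) ->
  forall t, 0 <= t <= b -> T (v t) = 0.
Proof.
move=> T_lin T_cont v_cont c0 Tv.
pose l := 2 * (c + 1).
have l0 : 0 < l by rewrite /l; lra.
pose P A := forall t, 0 <= t <= b -> nrm (T (v t)) <= A * expR (l * t).
have halve A : 0 <= A -> P A -> P (A / 2).
  move=> A0 PA t tb; have /andP[t0 t1] := tb.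
  have cTv : continuous (T \o v).
    by move=> s; apply: continuous_comp; [exact: v_cont|exact: T_cont].
  have H : nrm (T (integral_0t v t)) <= A * (expR (l * t) / l).
    apply/ler_addgt0Pr => e e0.
    (* The bound [P A] is inserted in the sums of [v], which converge in [V]; [T] carries the limit
       to [W]. *)
    have lim : T \o riemann_sum v t @ \oo --> T (integral_0t v t).
      by apply: cvg_comp; [exact: riemann_sum_cvg|exact: T_cont].
    have /cvg_nrmP/(_ _ e0)/filter_ex[n /= Hn] := lim.
    have := nrmD (T (integral_0t v t) - T (riemann_sum v t n)) (T (riemann_sum v t n)).
    rewrite subrK => /le_trans; apply; rewrite addrC lerD// ?(ltW Hn)//.
    rewrite (riemann_sum_linear _ _ _ T_lin).
    apply: (@le_trans _ _ (\sum_(k < n) t / n%:R * (A * expR (l * (k%:R * t / n%:R))))).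
      apply: (@riemann_sum_nrm_le R W (T \o v) (fun s => A * expR (l * s)) t n t0).
      by move=> s /andP[s0 st]; apply: PA; rewrite s0 (le_trans st).
    under eq_bigr do rewrite mulrCA.
    by rewrite -mulr_sumr ler_wpM2l// expR_riemann_sum_le.
  rewrite (le_trans (Tv t tb))//.
  apply: (le_trans (ler_wpM2l c0 H)).
  have := expR_gt0 (l * t); move: (expR _) => E E0.
  have -> : c * (A * (E / l)) = (A * E) * (c / l) by field; rewrite gt_eqF.
  have -> : A / 2 * E = A * E * 2^-1 by field.
  rewrite ler_wpM2l ?mulr_ge0 ?(ltW E0)// ler_pdivrMr// /l; lra.
have [M M0 HM] : exists2 M, 0 <= M & P M.
  have cTv : continuous (T \o v).
    by move=> s; apply: continuous_comp; [exact: v_cont|exact: T_cont].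
  have [M M0 HM] := segment_bounded b cTv.
  exists M; first exact: ltW.
  move=> t tb; rewrite (le_trans (HM t tb))// ler_peMr ?(ltW M0)//.
  by rewrite -expR0 ler_expR mulr_ge0// ?(ltW l0)//; case/andP: tb.
(* After [n] halvings the bounded quantity is still the same, so letting [n] grow forces it to be
   0. *)
have PM n : P (M * 2^-1 ^+ n).
  elim: n => [|n IH]; first by rewrite expr0 mulr1.
  by rewrite exprSr mulrA; apply: halve => //; rewrite mulr_ge0// exprn_ge0// invr_ge0.
move=> t tb; apply: nrm0_eq0; apply/eqP; rewrite eq_le nrm_ge0 andbT.
have : (fun n => M * 2^-1 ^+ n * expR (l * t)) @ \oo --> M * 0 * expR (l * t).
  apply: cvgM; last exact: cvg_cst.
  apply: cvgM; [exact: cvg_cst|apply: cvg_expr].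
  by rewrite gtr0_norm ?invr_gt0// invf_lt1// ltr1n.
rewrite mulr0 mul0r => lim.
rewrite -(cvg_lim (@Rhausdorff R) lim); apply: limr_ge; first by apply/cvg_ex; exists 0.
by apply: nearW => n; exact: PM.
Qed.

End Gronwall.

Section Average.
Variable R : realType.
Local Notation C := (complex R).

Lemma integral_0t0 (V : normedModType C) (F : R -> V) : integral_0t F 0 = 0.
Proof.
apply: integral_0t_unique; apply: cvg_near_cst; apply: nearW => n.
by rewrite /riemann_sum big1// => k _; rewrite mul0r scale0r.
Qed.

Variable V : completeNormedModType C.

(** [c] is its own average over [0,h], so the difference is the average of [c - F s]. This controls
    the difference quotients in [integral_vsol_generator]. *)
Lemma integral_0t_average (F : R -> V) (c : V) (h e : R) :
  continuous F -> 0 < h -> 0 <= e ->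
  (forall s, 0 <= s <= h -> nrm (c - F s) <= e) ->
  nrm (c - (h^-1)%:C%C *: integral_0t F h) <= e.
Proof.
move=> cF h0 e0 cFe; have h0' := ltW h0.
have cc : continuous (fun s : R => c : V) by move=> s; exact: cvg_cst.
have -> : c - (h^-1)%:C%C *: integral_0t F h
    = (h^-1)%:C%C *: integral_0t (fun s => c - F s) h.
  rewrite integral_0tB// integral_0t_cst scalerBr scalerA -rmorphM/= mulVf ?gt_eqF//.
  by rewrite scale1r.
rewrite nrmZr gtr0_norm ?invr_gt0// ler_pdivrMl//; apply: integral_0t_bound => //.
by move=> s; apply: cvgB; [exact: cvg_cst|exact: cF].
Qed.

End Average.

Section ContinuityRules.
Variables (R : realType) (V : normedModType (complex R)).
Local Notation C := (complex R).

Lemma continuous_scale (k : R -> C^o) (F : R -> V) :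
  continuous k -> continuous F -> continuous (fun s => k s *: F s).
Proof. by move=> ck cF s; apply: cvgZ; [exact: ck|exact: cF]. Qed.

Lemma continuous_shift (F : R -> V) a : continuous F -> continuous (fun s => F (a + s)).
Proof.
move=> cF s; apply: (@continuous_comp _ _ _ (fun s => a + s) F); last exact: cF.
by apply: cvgD; [exact: cvg_cst|exact: cvg_id].
Qed.

Lemma continuous_reflect (F : R -> V) a :
  continuous F -> continuous (fun s => F (a - s)).
Proof.
move=> cF s; apply: (@continuous_comp _ _ _ (fun s => a - s) F); last exact: cF.
by apply: cvgB; [exact: cvg_cst|exact: cvg_id].
Qed.

End ContinuityRules.

(** * The convolution with an orbit, and the generator on the integral of v *)

Section Convolution.
Variable R : realType.
Local Notation C := (complex R).
Variable H : completeNormedModType C.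
Variable ip : H -> H -> C.
Hypothesis ip_linl :
  forall (a : C) (x y v : H), ip (a *: x + y) v = a * ip x v + ip y v.
Hypothesis ip_sym : forall x y : H, ip y x = conjc (ip x y).
Hypothesis ip_norm : forall x : H, ip x x = `|x| ^+ 2.
Variable U : R -> H -> H.
Hypothesis U_lin : forall t (a : C) (x y : H), 0 <= t ->
  U t (a *: x + y) = a *: U t x + U t y.
Hypothesis U_cont : forall t, 0 <= t -> continuous (U t).
Hypothesis U0 : forall x, U 0 x = x.
Hypothesis U_semi : forall t s x, 0 <= t -> 0 <= s -> U (t + s) x = U t (U s x).
Hypothesis U_strong : forall x, U t x @[t --> 0^'+] --> x.
Variables (f : R -> C^o) (y z : H).
Hypothesis f_cont : continuous f.

(** The orbit of [z], frozen at [z] for negative times, which makes the integrands continuous on the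
    whole line. *)
Let g (t : R) := U (Num.max 0 t) z.

Let gE t : 0 <= t -> g t = U t z.
Proof. by move=> t0; rewrite /g max_r. Qed.

Let g_cont : continuous g.
Proof. exact: (orbit_continuous U_lin U_cont U0 U_semi U_strong). Qed.


(** The difference [t - s] sits on the orbit rather than on [f]: when [t] is shifted, the semigroup
    law acts on the kernel while [f] stays in place. [convE] gives the form used in the theorem. *)
Definition conv (t : R) : H := integral_0t (fun s => f s *: g (t - s)) t.

Let convI_cont t : continuous (fun s => f s *: g (t - s)).
Proof. by apply: continuous_scale => //; exact: continuous_reflect. Qed.

Let convK_cont s h : continuous (fun r => f (s + r) *: g (h - r)).
Proof.
apply: continuous_scale; last exact: continuous_reflect.
exact: (@continuous_shift R C^o).
Qed.

Lemma convE t : 0 <= t -> conv t = integral_0t (fun s => f (t - s) *: U s z) t.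
Proof.
move=> t0; rewrite /conv -integral_0t_rev//.
by apply: integral_0t_eq => // s /andP[s0 _]; rewrite subKr gE.
Qed.

Let split_conv t h : 0 <= t -> 0 <= h ->
  conv (t + h) = integral_0t (fun s => f s *: g (t + h - s)) t
    + integral_0t (fun r => f (t + r) *: g (h - r)) h.
Proof.
move=> t0 h0; rewrite /conv (integral_0t_chasles ip_linl ip_sym ip_norm)//.
congr (_ + _); congr (integral_0t _ h); apply/funext => r.
by congr (_ *: g _); ring.
Qed.

(** For [s <= t] the kernel satisfies [g (t + h - s) = U h (g (t - s))], so [U h] comes out of the
    part over [0,t]. *)
Lemma conv_shift t h : 0 <= t -> 0 <= h ->
  conv (t + h) = U h (conv t) + integral_0t (fun r => f (t + r) *: g (h - r)) h.
Proof.
move=> t0 h0; rewrite split_conv//; congr (_ + _).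
rewrite (integral_0t_linear (fun a p q => U_lin a p q h0) (U_cont h0))//.
apply: integral_0t_eq => // s /andP[s0 st].
rewrite (linZ (fun a p q => U_lin a p q h0)) !gE; last 2 first.
- by rewrite subr_ge0.
- by rewrite subr_ge0 (le_trans st)// lerDl.
by rewrite -U_semi ?subr_ge0//; congr (_ *: U _ z); ring.
Qed.

Lemma conv_continuous : continuous (fun t : R => conv (Num.max 0 t)).
Proof.
apply: continuous_max0 => b e e0.
(* [h < 1] keeps [r + s] below [b + 1]. Half of [e] goes to each error: the shifted kernel over
   [0,r], and the new piece of length [h]. *)
have [Mf Mf0 HMf] := segment_bounded (b + 1) f_cont.
have [Mg Mg0 HMg] := segment_bounded 1 g_cont.
have b1 : 0 < `|b| + 1 by rewrite ltr_wpDl.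
have eps0 : 0 < e / (2 * Mf * (`|b| + 1)) by rewrite divr_gt0// !mulr_gt0.
have [d1 d10 Hd1] := segment_unif_continuous_nrm 0 b g_cont eps0.
have d20 : 0 < e / (2 * Mf * Mg) by rewrite divr_gt0// !mulr_gt0.
exists (Num.min d1 (Num.min 1 (e / (2 * Mf * Mg)))).
  by rewrite !lt_min d10 ltr01 d20.
move=> r h /andP[r0 rb] /andP[h0]; rewrite !lt_min => /andP[hd1 /andP[h1 hd2]].
rewrite split_conv// opprD addrA -integral_0tB//.
rewrite (le_lt_trans (nrmB _ _))//.
have -> : e = e / 2 + e / 2 by lra.
apply: ler_ltD.
  apply: (@le_trans _ _ (r * (e / (2 * (`|b| + 1))))).
    apply: integral_0t_bound => //.
    - by move=> s; apply: cvgB; exact: convI_cont.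
    - by rewrite divr_ge0 ?mulr_ge0// ltW.
    move=> s /andP[s0 sr]; rewrite -scalerBr nrmZ.
    have -> : e / (2 * (`|b| + 1)) = Mf * (e / (2 * Mf * (`|b| + 1))).
      by field; rewrite !gt_eqF.
    apply: ler_pM; rewrite ?nrm_ge0//; first by apply: HMf; lra.
    apply/ltW/Hd1; first by lra.
    have -> : r - s - (r + h - s) = - h by ring.
    by rewrite normrN ger0_norm.
  have -> : r * (e / (2 * (`|b| + 1))) = e / 2 * (r / (`|b| + 1)).
    by field; rewrite gt_eqF.
  rewrite ler_piMr ?divr_ge0 ?(ltW e0)// ler_pdivrMr// mul1r.
  by have := ler_norm b; lra.
apply: (@le_lt_trans _ _ (h * (Mf * Mg))).
  apply: integral_0t_bound => //; first by rewrite mulr_ge0// ltW.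
  move=> s /andP[s0 sh]; rewrite nrmZ; apply: ler_pM; rewrite ?nrm_ge0//.
    by apply: HMf; lra.
  by apply: HMg; lra.
move: hd2; rewrite ltr_pdivlMr ?mulr_gt0//; lra.
Qed.

Definition vsol (t : R) : H := U (Num.max 0 t) y - conv (Num.max 0 t).

Lemma vsolE t : 0 <= t -> vsol t = U t y - conv t.
Proof. by move=> t0; rewrite /vsol max_r. Qed.

Lemma vsol0 : vsol 0 = y.
Proof. by rewrite vsolE// U0 /conv integral_0t0 subr0. Qed.

Lemma vsol_continuous : continuous vsol.
Proof.
move=> t; apply: cvgB; last exact: conv_continuous.
exact: (orbit_continuous U_lin U_cont U0 U_semi U_strong).
Qed.

Let defect_cont h : 0 <= h -> continuous (fun s => U h (vsol s) - vsol (h + s)).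
Proof.
move=> h0 s; apply: cvgB; last exact: continuous_shift vsol_continuous _.
by apply: (@continuous_comp _ _ _ vsol (U h)); [exact: vsol_continuous|exact: U_cont].
Qed.

(** [vsol] fails to be an orbit by the forcing accumulated over a time [h]; divided by [h] this
    tends to [f s *: z], the source of the term (int f) z. *)
Let defectE h s : 0 <= h -> 0 <= s ->
  U h (vsol s) - vsol (h + s) = integral_0t (fun r => f (s + r) *: g (h - r)) h.
Proof.
move=> h0 s0; rewrite !vsolE ?addr_ge0// (linB (fun a p q => U_lin a p q h0)).
rewrite -U_semi// [h + s]addrC conv_shift//.
by rewrite opprB 2!addrA subrK addrAC subrr add0r.
Qed.

(** Splitting the integral over [0,t+h] both at [t] and at [h] evaluates the integral of
    [vsol (h + s)] over [0,t]; replacing [vsol (h + s)] by [U h (vsol s)] costs the last term. *)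
Lemma semigroup_increment t h : 0 <= t -> 0 <= h ->
  U h (integral_0t vsol t) - integral_0t vsol t
  = integral_0t (fun s => vsol (t + s)) h - integral_0t vsol h
    + integral_0t (fun s => U h (vsol s) - vsol (h + s)) t.
Proof.
move=> t0 h0.
have cv := vsol_continuous.
have csh : continuous (fun s => vsol (h + s)) by exact: continuous_shift.
have cU : continuous (fun s => U h (vsol s)).
  by move=> s; apply: (@continuous_comp _ _ _ vsol (U h)); [exact: cv|exact: U_cont].
rewrite integral_0tB//.
rewrite -(integral_0t_linear (fun a p q => U_lin a p q h0) (U_cont h0))//.
have := integral_0t_chasles ip_linl ip_sym ip_norm cv h0 t0.
rewrite addrC (integral_0t_chasles ip_linl ip_sym ip_norm cv t0 h0).
move: (integral_0t vsol h) (integral_0t vsol t) => b j.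
move: (integral_0t _ h) (integral_0t _ t) => a c E.
have -> : a = b + c - j by rewrite -E addrC addKr.
by rewrite [b + c - j - b]addrAC [b + c]addrC addrK [RHS]addrC addrA subrK.
Qed.

(** Divided by [h], the three terms of [semigroup_increment] tend to [vsol t], [vsol 0 = y] and the
    integral of [f s *: z]; for the last, the averages of [f (s + r) *: g (h - r)] over [r] approach
    [f s *: z] uniformly in [s]. *)
Lemma integral_vsol_generator t : 0 <= t ->
  generator U (integral_0t vsol t)
    (vsol t - y + integral_0t (fun s => f s *: z) t).
Proof.
move=> t0; apply/(@cvg_nrmP _ H) => e e0.
have cv := vsol_continuous.
have e4 : 0 < e / 4 by lra.
have e34 : e / 4 + e / 4 + e / 4 < e by lra.
have [Mf Mf0 HMf] := segment_bounded t f_cont.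
have [Mg Mg0 HMg] := segment_bounded 1 g_cont.
(* [t * eps <= e / 4] pays for integrating over [0,t]; [eps] is halved between the drift of the
   orbit from [z], weighted by [Mf], and the variation of [f], weighted by [Mg]. *)
pose eps := e / (4 * (t + 1)).
have t1 : 0 < t + 1 by lra.
have eps0 : 0 < eps by rewrite divr_gt0// mulr_gt0.
have epsf : 0 < eps / (2 * Mf) by rewrite divr_gt0// mulr_gt0.
have epsg : 0 < eps / (2 * Mg) by rewrite divr_gt0// mulr_gt0.
have [d1 d10 Hd1] := segment_unif_continuous_nrm 0 t f_cont epsg.
have [d2 d20 Hd2] := iffLR (continuous_nrmP _ _) (@g_cont 0) _ epsf.
have [d3 d30 Hd3] := iffLR (continuous_nrmP _ _) (@cv t) _ e4.
have [d4 d40 Hd4] := iffLR (continuous_nrmP _ _) (@cv 0) _ e4.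
near=> h.
have h0 : 0 < h by near: h; exact: nbhs_right_gt.
have h0' := ltW h0.
have h1 : h < 1 by near: h; exact: nbhs_right_lt.
have hd1 : h < d1 by near: h; exact: nbhs_right_lt.
have hd2 : h < d2 by near: h; exact: nbhs_right_lt.
have hd3 : h < d3 by near: h; exact: nbhs_right_lt.
have hd4 : h < d4 by near: h; exact: nbhs_right_lt.
rewrite semigroup_increment//.
set Z := integral_0t _ t; set A := integral_0t _ h; set B := integral_0t _ h.
set K := integral_0t _ t; set i := (h^-1)%:C%C.
have -> : vsol t - y + Z - i *: (A - B + K)
    = (vsol t - i *: A) - (y - i *: B) + (Z - i *: K).
  rewrite scalerDr scalerBr !opprD !opprK addrACA; congr (_ + _).
  by rewrite addrACA.
have HA : nrm (vsol t - i *: A) <= e / 4.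
  apply: integral_0t_average => //; [exact: continuous_shift|exact: ltW|].
  move=> s /andP[s0 sh]; apply/ltW/Hd3.
  by rewrite opprD addrA subrr add0r normrN ger0_norm// (le_lt_trans sh).
have HB : nrm (y - i *: B) <= e / 4.
  apply: integral_0t_average => //; first exact: ltW.
  move=> s /andP[s0 sh]; rewrite -{1}vsol0; apply/ltW/Hd4.
  by rewrite sub0r normrN ger0_norm// (le_lt_trans sh).
have HZ : nrm (Z - i *: K) <= e / 4.
  have cz : continuous (fun s => f s *: z).
    by apply: continuous_scale => // s; exact: cvg_cst.
  have cD := defect_cont h0'.
  have cDi : continuous (fun s => i *: (U h (vsol s) - vsol (h + s))).
    by move=> s; apply: cvgZl_tmp; exact: cD.
  rewrite -integral_0tZ// -integral_0tB//.
  apply: (@le_trans _ _ (t * eps)); last first.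
    have -> : t * eps = e / 4 * (t / (t + 1)) by rewrite /eps; field; rewrite gt_eqF.
    by rewrite ler_piMr ?(ltW e4)// ler_pdivrMr// mul1r lerDl.
  apply: integral_0t_bound => //; [|exact: ltW|].
    by move=> s; apply: cvgB; [exact: cz|exact: cDi].
  move=> s /andP[s0 st]; rewrite defectE//.
  apply: integral_0t_average => //; first exact: ltW.
  move=> r /andP[r0 rh].
  have -> : f s *: z - f (s + r) *: g (h - r)
      = f s *: (g 0 - g (h - r)) + (f s - f (s + r)) *: g (h - r).
    by rewrite (gE (lexx 0)) U0 scalerBr scalerBl addrA subrK.
  rewrite (le_trans (nrmD _ _))// !nrmZ.
  have -> : eps = Mf * (eps / (2 * Mf)) + eps / (2 * Mg) * Mg.
    by field; rewrite !gt_eqF.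
  apply: lerD; apply: ler_pM; rewrite ?nrm_ge0//.
  - by apply: HMf; rewrite s0 st.
  - apply/ltW/Hd2; rewrite sub0r normrN ger0_norm ?subr_ge0//.
    by rewrite (le_lt_trans _ hd2)// lerBlDr lerDl.
  - apply/ltW/Hd1; first by rewrite s0 st.
    by rewrite opprD addrA subrr add0r normrN ger0_norm// (le_lt_trans rh).
  - by apply: HMg; rewrite subr_ge0 rh lerBlDr (le_trans (ltW h1))// lerDl.
rewrite (le_lt_trans (nrmD _ _))// (le_lt_trans _ e34)// lerD//.
by rewrite (le_trans (nrmB _ _))// lerD.
Unshelve. all: by end_near. Qed.

End Convolution.

Lemma max0_continuous (R : realType) : continuous (Num.max (0 : R)).
Proof.
move=> t; apply/cvgrPdist_lt => e e0; apply/nbhs_normP; exists e => //= s /=.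
apply: le_lt_trans; have := ler_norm (t - s); have := ler_norm (s - t).
rewrite [`|s - t|]distrC => ? ?; rewrite ler_norml /Num.max.
by case: ltP => ?; case: ltP => ?; apply/andP; split; lra.
Qed.

(** [Num.max 0] is a continuous retraction of the line onto the closed half-line. *)
Lemma within_ge0_continuousP (R : realType) (V : topologicalType) (f : R -> V) :
  {within [set t : R | 0 <= t], continuous f} <->
  continuous (fun t : R => f (Num.max 0 t)).
Proof.
split=> [cf t|cf].
  have mt : [set t : R | 0 <= t] (Num.max 0 t) by rewrite /= le_max lexx.
  apply: (@cvg_comp _ _ _ (Num.max 0) f _ (within [set t : R | 0 <= t] (nbhs (Num.max 0 t)))).
    move=> A HA.
    have HA' : nbhs t (fun s => 0 <= Num.max 0 s -> A (Num.max 0 s)).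
      exact: (@max0_continuous R t _ HA).
    by apply: filterS HA' => s; apply; rewrite le_max lexx.
  by rewrite (nbhs_subspace_in mt); exact: cf.
apply: (@subspace_eq_continuous _ _ _ (fun t : R => f (Num.max 0 t))).
  by move=> t; rewrite inE /= => t0; rewrite max_r.
exact: continuous_subspaceT.
Qed.

(** * Orthogonality of v to z *)

Section RankOneProjection.
Variable R : realType.
Local Notation C := (complex R).
Variable H : completeNormedModType C.
Variable ip : H -> H -> C.
Hypothesis ip_linl :
  forall (a : C) (x y v : H), ip (a *: x + y) v = a * ip x v + ip y v.
Hypothesis ip_sym : forall x y : H, ip y x = conjc (ip x y).
Hypothesis ip_norm : forall x : H, ip x x = `|x| ^+ 2.
Variable U : R -> H -> H.
Hypothesis U_lin : forall t (a : C) (x y : H), 0 <= t ->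
  U t (a *: x + y) = a *: U t x + U t y.
Hypothesis U_cont : forall t, 0 <= t -> continuous (U t).
Hypothesis U0 : forall x, U 0 x = x.
Hypothesis U_semi : forall t s x, 0 <= t -> 0 <= s -> U (t + s) x = U t (U s x).
Hypothesis U_strong : forall x, U t x @[t --> 0^'+] --> x.
Variables z w : H.
Hypothesis z_adj : forall x y, generator U x y -> ip y z = ip x w.
Variables (f : R -> C^o) (y : H).
Hypothesis f_cont : continuous f.
Hypothesis y_orth : ip y z = 0.

(** [q] is Q L^dagger z; [f_volterra] below is the Volterra equation multiplied by (z,z), its right
    side read as one pairing with [v]. *)
Let q := w - (ip w z / ip z z) *: z.
Local Notation v := (vsol U f y z).

Hypothesis f_volterra : forall t, 0 <= t -> f t * ip z z = ip (v t) q.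

Let v_cont : continuous v.
Proof. exact: (vsol_continuous ip_linl ip_sym ip_norm). Qed.

Let ip_lin u : forall a p r, ip (a *: p + r) u = a *: (ip p u : C^o) + ip r u.
Proof. by move=> a p r; rewrite ip_linl. Qed.

(** The Volterra relation integrated over [0,t]; it trades the unknown [f] for a pairing with the
    integral of [v]. *)
Lemma ip_integral_fz t : 0 <= t ->
  ip (integral_0t (fun s => f s *: z) t) z = ip (integral_0t v t) q.
Proof.
move=> t0; have cz : continuous (fun s => f s *: z).
  by apply: continuous_scale => // s; exact: cvg_cst.
rewrite (ip_integral_0t ip_linl ip_sym ip_norm z cz t0).
rewrite (ip_integral_0t ip_linl ip_sym ip_norm q v_cont t0).
apply: (@integral_0t_eq R C^o) => // s /andP[s0 _].
by rewrite (ipZl ip_linl) f_volterra.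
Qed.

(* Pairing L (int v) = v t - y + (int f) z with z gives a linear homogeneous
   Volterra equation for (v t, z). *)
Lemma ip_vsol_eq t : 0 <= t ->
  ip (v t) z = conjc (ip w z / ip z z) * ip (integral_0t v t) z.
Proof.
move=> t0.
have := z_adj (integral_vsol_generator ip_linl ip_sym ip_norm U_lin U_cont U0 U_semi
  U_strong (y := y) (z := z) f_cont t0).
rewrite (ipDl ip_linl) (ipBl ip_linl) y_orth subr0 ip_integral_fz// => E.
rewrite -(ipZr ip_linl ip_sym).
(* The [q] part of [w] has been matched by the integral of [f]; only the multiple of [z] is left,
   its coefficient conjugated by the second slot. *)
have -> : (ip w z / ip z z) *: z = w - q by rewrite /q subKr.
by rewrite (ipBr ip_linl ip_sym) -E addrK.
Qed.

Lemma ip_vsol_eq0 t : 0 <= t -> ip (v t) z = 0.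
Proof.
move=> t0; set c := conjc (ip w z / ip z z) : C^o.
have H1 s : 0 <= s <= t ->
    nrm (ip (v s) z : C^o) <= nrm c * nrm (ip (integral_0t v s) z : C^o).
  by move=> /andP[s0 _]; rewrite ip_vsol_eq// nrmM.
apply: (gronwall_eq0 (W := C^o) (ip_lin z) (ip_continuous ip_linl ip_sym ip_norm (v := z))
  v_cont (nrm_ge0 c) H1).
by rewrite t0 lexx.
Qed.

Lemma ip_integral_vsol_eq0 t : 0 <= t -> ip (integral_0t v t) z = 0.
Proof.
move=> t0.
rewrite (ip_integral_0t ip_linl ip_sym ip_norm z v_cont t0).
rewrite (@integral_0t_eq R C^o _ (fun=> 0))// => [|s /andP[s0 _]]; last exact: ip_vsol_eq0.
by rewrite integral_0t_cst scaler0.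
Qed.

End RankOneProjection.

Unset Implicit Arguments.

Theorem theorem2 (R : realType)
  (* complex Hilbert space H: complete normed space over C = R[i] whose norm
     comes from an inner product ip, linear in the 1st, conjugate-linear in
     the 2nd argument *)
  (H : completeNormedModType (complex R)) (ip : H -> H -> complex R)
  (ip_linl : forall (a : complex R) (x y v : H), ip (a *: x + y) v = a * ip x v + ip y v)
  (ip_sym : forall x y : H, ip y x = conjc (ip x y))
  (ip_norm : forall x : H, ip x x = `|x| ^+ 2)
  (* strongly continuous semigroup {U t}_{t >= 0} of bounded operators *)
  (U : R -> H -> H)
  (U_lin : forall t (a : complex R) (x y : H), 0 <= t -> U t (a *: x + y) = a *: U t x + U t y)
  (U_cont : forall t, 0 <= t -> continuous (U t))
  (U0 : forall x, U 0 x = x)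
  (U_semi : forall t s x, 0 <= t -> 0 <= s -> U (t + s) x = U t (U s x))
  (U_strong : forall x, U t x @[t --> 0^'+] --> x)
  (* z \in D(L^dagger), w = L^dagger z *)
  (z w : H) (z_neq0 : z != 0)
  (z_adj : forall x y, generator U x y -> ip y z = ip x w)
  (x : H)
  (* f(x,.) : continuous solution of the Volterra equation *)
  (f : R -> (complex R)^o)
  (f_cont : {within [set t : R | 0 <= t], continuous f})
  (f_volterra : forall t, 0 <= t ->
     f t = ip (U t (x - (ip x z / ip z z) *: z)) (w - (ip w z / ip z z) *: z) / ip z z
           - integral_0t (fun s => (f (t - s) * (ip (U s z) (w - (ip w z / ip z z) *: z) / ip z z)
                                   : (complex R)^o)) t) :
  let P := fun y : H => (ip y z / ip z z) *: z in
  let Q := fun y : H => y - P y in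
  let u := fun t : R => P x + U t (Q x) - integral_0t (fun s => f (t - s) *: U s z) t in
  (* graph of the closure of QL (QL has domain D(L)) *)
  let graph_QL := [set p : H * H | exists y, generator U p.1 y /\ p.2 = Q y] in
  {within [set t : R | 0 <= t], continuous u} /\
  (forall t : R, 0 <= t -> closure graph_QL (Q (integral_0t u t), u t - x)).
Proof.
move=> P Q u graph_QL.
have zz0 : ip z z != 0 by apply: contra_neq z_neq0 => /(ip_eq0 ip_norm).
have f0_cont : continuous (fun t : R => f (Num.max 0 t)) by exact/within_ge0_continuousP.
pose f0 (t : R) := f (Num.max 0 t); pose v := vsol U f0 (Q x) z.
have v_cont : continuous v by exact: (vsol_continuous ip_linl ip_sym ip_norm).
have convol t : 0 <= t -> conv U f0 z t = integral_0t (fun s => f (t - s) *: U s z) t.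
  move=> t0; rewrite (convE U_lin U_cont U0 U_semi U_strong)//.
  by apply: integral_0t_eq => // s /andP[_ st]; rewrite /f0 max_r// subr_ge0.
have uE t : 0 <= t -> u t = P x + v t.
  by move=> t0; rewrite /u /v vsolE// convol// addrA.
have Qx_orth : ip (Q x) z = 0.
  by rewrite (ipBl ip_linl) (ipZl ip_linl) divfK// subrr.
set q := w - (ip w z / ip z z) *: z in f_volterra.
have volt t : 0 <= t -> f0 t * ip z z = ip (v t) q.
  move=> t0; rewrite /f0 max_r// f_volterra// /v vsolE// (ipBl ip_linl).
  rewrite mulrBl divfK//; congr (_ - _).
  pose G (s : R) := f0 (t - s) *: U (Num.max 0 s) z.
  have G_cont : continuous G.
    apply: continuous_scale; first exact: (@continuous_reflect R (complex R)^o).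
    exact: (orbit_continuous U_lin U_cont U0 U_semi U_strong).
  have GE s : 0 <= s <= t -> G s = f (t - s) *: U s z.
    by move=> /andP[s0 st]; rewrite /G /f0 !max_r// subr_ge0.
  rewrite convol// -(integral_0t_eq t0 GE).
  (* Rescaling [q] absorbs the division by (z,z) into the pairing, so that one exchange of pairing
     and integral gives the integrand of the Volterra equation. *)
  pose q' := conjc (ip z z)^-1 *: q.
  have q'E p : ip p q' = ip p q / ip z z.
    by rewrite (ipZr ip_linl ip_sym) conjcK mulrC.
  have -> : ip (integral_0t G t) q = ip (integral_0t G t) q' * ip z z.
    by rewrite q'E divfK.
  congr (_ * _); rewrite (ip_integral_0t ip_linl ip_sym ip_norm q' G_cont t0).
  apply: (@integral_0t_eq R (complex R)^o) => // s st.
  by rewrite q'E GE// (ipZl ip_linl) mulrA.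
split.
  apply/within_ge0_continuousP.
  rewrite (_ : (fun t : R => u (Num.max 0 t)) = (fun t : R => P x + v (Num.max 0 t))); last first.
    by apply/funext => s; rewrite uE// le_max lexx.
  move=> t; apply: cvgD; first exact: cvg_cst.
  exact: (cvg_comp (Num.max 0) v (@max0_continuous R t) (@v_cont _)).
move=> t t0; apply: subset_closure.
have orthv := ip_vsol_eq0 ip_linl ip_sym ip_norm U_lin U_cont U0 U_semi U_strong z_adj
  f0_cont Qx_orth volt t0.
have orthJ := ip_integral_vsol_eq0 ip_linl ip_sym ip_norm U_lin U_cont U0 U_semi U_strong
  z_adj f0_cont Qx_orth volt t0.
have gen := integral_vsol_generator ip_linl ip_sym ip_norm U_lin U_cont U0 U_semi
  U_strong (y := Q x) (z := z) f0_cont t0.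
(* [Q] kills the multiple [t P x] of [z] and fixes the integral of [v], which is orthogonal to
   [z]. *)
have -> : Q (integral_0t u t) = integral_0t v t.
  have -> : integral_0t u t = t%:C%C *: P x + integral_0t v t.
    rewrite -integral_0t_cst -integral_0tD//; last by move=> s; exact: cvg_cst.
    by apply: integral_0t_eq => // s /andP[s0 _]; rewrite uE.
  rewrite /Q /P (ipDl ip_linl) !(ipZl ip_linl) orthJ addr0 divfK// -mulrA scalerA.
  by rewrite addrC addKr.
exists (vsol U f0 (Q x) z t - Q x + integral_0t (fun s => f0 s *: z) t); split => //=.
set Z := integral_0t _ t.
(* Since Q Z is orthogonal to [z], (Q Z, Q Z) = (Z, Q Z), and this is 0 by pairing under the
   integral; no scalar integral of [f0] has to be formed. *)
have QZ : Q Z = 0.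
  have Qz p : ip (Q p) z = 0 by rewrite (ipBl ip_linl) (ipZl ip_linl) divfK// subrr.
  have zQ p : ip z (Q p) = 0 by rewrite ip_sym Qz conjc0.
  apply: (ip_eq0 ip_norm); rewrite {1}/Q (ipBl ip_linl) (ipZl ip_linl) zQ mulr0 subr0.
  have cz : continuous (fun s => f0 s *: z).
    by apply: continuous_scale => // s; exact: cvg_cst.
  rewrite {1}/Z (ip_integral_0t ip_linl ip_sym ip_norm (Q Z) cz t0).
  rewrite (@integral_0t_eq R (complex R)^o _ (fun=> 0))// => [|s _].
    by rewrite integral_0t_cst scaler0.
  by rewrite (ipZl ip_linl) zQ mulr0.
have PZ : P Z = Z by apply/esym/eqP; rewrite -subr_eq0; apply/eqP.
(* [v t] and [Q x] are orthogonal to [z], so [Q] removes exactly [Z] from the value of the generator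
   and leaves [v t - Q x = u t - x]. *)
have PE : P (v t - Q x + Z) = Z.
  by rewrite /P (ipDl ip_linl) (ipBl ip_linl) orthv Qx_orth subrr add0r.
by rewrite uE// {1}/Q PE addrK -/v opprB; move: (v t) => vt; rewrite addrCA addrA.
Qed.
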